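(* Let $R$ be a ring in which every nilpotent element is central (commutes multiplicatively with every element of $R$) and torsion (has finite order in the additive group $R^+$). Then $R$ is nilperiod; that is, for every nonzero nilpotent element $r \in R$ there is a positive integer $n$ such that $(x+r)^n = x^n$ for all $x \in R$.
   Context: Rings are associative, not necessarily commutative or unital. $R^+$ denotes the additive group of $R$. A power map over $R$ is a function $R \to R$ of the form $f(x) = x^n$ for a fixed positive integer $n$. A period of a function $f$ on $R^+$ is a nonzero $h \in R$ with $f(x+h) = f(x)$ for all $x \in R$. A ring is called nilperiod if each of its nonzero nilpotent elements is a period of some power map over the ring. *)

(* Defs.v *)
From HB Require Import structures.
From mathcomp Require Import all_boot all_algebra.

Set Implicit Arguments.
Unset Strict Implicit.
Unset Printing Implicit Defensive.

Local Open Scope ring_scope.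

(* MathComp's ring structures all have a unit.  A ring that need not have one
   is an abelian group and a multiplicative semigroup on the same carrier,
   related by distributivity.  The product is the semigroup operation, hence
   written in group_scope, while addition is written in ring_scope. *)
HB.mixin Record ZmoduleSemigroup_isRng R of GRing.Zmodule R & Semigroup R := {
  rng_mulDl : forall x y z : R, ((x + y)%R * z)%g = (x * z)%g + (y * z)%g;
  rng_mulDr : forall x y z : R, (x * (y + z)%R)%g = (x * y)%g + (x * z)%g
}.

#[short(type="rngType")]
HB.structure Definition Rng :=
  {R of ZmoduleSemigroup_isRng R & GRing.Zmodule R & Semigroup R}.

(* Without a unit x ^ 0 is meaningless: the value 0 at n = 0 is a dummy, and
   every use below requires 0 < n. *)
Definition rng_exp (R : rngType) (x : R) (n : nat) : R := iterop n *%g x 0.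

Definition power_map (R : rngType) (f : R -> R) : Prop :=
  exists2 n : nat, (0 < n)%N & forall x : R, f x = rng_exp x n.

Definition period (R : rngType) (f : R -> R) (h : R) : Prop :=
  h <> 0 /\ forall x : R, f (x + h) = f x.

Definition nilpotent_elt (R : rngType) (r : R) : Prop :=
  exists2 n : nat, (0 < n)%N & rng_exp r n = 0.

Definition central_elt (R : rngType) (r : R) : Prop :=
  forall x : R, commute r x.

Definition torsion_elt (R : rngType) (r : R) : Prop :=
  exists2 n : nat, (0 < n)%N & r *+ n = 0.

Definition nilperiod (R : rngType) : Prop :=
  forall r : R, r <> 0 -> nilpotent_elt r ->
    exists2 f : R -> R, power_map f & period f r.

Lemma nilperiodP (R : rngType) :
  nilperiod R <->
  forall r : R, r <> 0 -> nilpotent_elt r ->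
    exists2 n : nat, (0 < n)%N
      & forall x : R, rng_exp (x + r) n = rng_exp x n.
Proof.
split=> nilR r r_neq0 r_nil; have := nilR r r_neq0 r_nil.
  move=> [f [n n_gt0 fE] [_ fP]]; exists n => // x.
  by rewrite -!fE fP.
move=> [n n_gt0 expP]; exists (fun x => rng_exp x n); first by exists n.
by split.
Qed.

(* Main.v *)
Require Import Defs.
From HB Require Import structures.
From mathcomp Require Import all_boot all_algebra.

(** As [x] and the central nilpotent element [r] commute, the binomial theorem
    gives [(x + r)^n = x^n + \sum_(0 < i <= n) 'C(n, i) x^(n - i) r^i].
    If [r^k = 0], the terms with [k <= i] vanish; if moreover [m r = 0], so do
    the terms for which [m] divides ['C(n, i)].  Hence it suffices to find
    [n > 0] such that [m] divides ['C(n, i)] for all [0 < i < k], and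
    [n = m * k`!] works ([dvdn_bin_mul_fact]).  The same [n] serves every [x].

    The binomial theorem involves [x^0], which makes no sense in a ring without
    unit.  The computation therefore takes place in a larger structure with
    unit, obtained by adjoining the natural numbers to [R]: the variant of the
    Dorroh extension with [nat] in place of the integers.  The result is a
    semiring, which is enough structure for the binomial theorem, and the only
    scalars that act on [R] are then natural multiples. *)

Set Implicit Arguments.
Unset Strict Implicit.
Unset Printing Implicit Defensive.

Import GRing.Theory.
Local Open Scope ring_scope.

(** From [i.+1 * 'C(n, i.+1) = n * 'C(n.-1, i)]: when [n = m * k`!], the factor
    [i.+1] can be cancelled against [k`!], which leaves [m] intact. *)
Lemma dvdn_bin_mul_fact (m k i : nat) :
  (i < k)%N -> (m %| 'C(m * k`!, i.+1))%N.
Proof.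
move=> i_lt_k.
have /dvdnP[q kE] : (i.+1 %| k`!)%N by rewrite dvdn_fact.
have /eqP := mul_bin_diag (m * k`!) i.
rewrite {1}kE mulnA [X in X == _]mulnAC [X in X == _]mulnC eqn_pmul2l //.
by move=> /eqP <-; rewrite -mulnA dvdn_mulr.
Qed.

Lemma exprD_nilp_torsion (S : pzSemiRingType) (x r : S) (k m : nat) :
    GRing.comm x r -> r ^+ k = 0 -> r *+ m = 0 ->
  (x + r) ^+ (m * k`!) = x ^+ (m * k`!).
Proof.
move=> xr rk0 rm0; rewrite exprDn_comm // big_ord_recl /=.
rewrite subn0 expr0 mulr1 bin0 mulr1n big1 ?addr0 // => i _.
rewrite [bump _ _]/=; case: (ltnP i k) => [i_lt_k | k_le_i].
  have /dvdnP[q ->] := dvdn_bin_mul_fact m i_lt_k.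
  by rewrite (mulnC q) mulrnA exprS -mulrnAr -mulrnAl rm0 mul0r mulr0 mul0rn.
by rewrite /bump /= -(subnK k_le_i) addnA exprD rk0 !mulr0 mul0rn.
Qed.

Section AdjoinUnit.

Variable R : rngType.
Implicit Types x y z r : R.

Lemma rng_mul0l x : (0 * x)%g = 0 :> R.
Proof. by apply: (addrI (0 * x)%g); rewrite -rng_mulDl !addr0. Qed.

Lemma rng_mul0r x : (x * 0)%g = 0 :> R.
Proof. by apply: (addrI (x * 0)%g); rewrite -rng_mulDr !addr0. Qed.

Lemma rng_mulrnAl x y n : (x *+ n * y)%g = (x * y)%g *+ n.
Proof.
by elim: n => [|n IHn]; rewrite ?rng_mul0l // !mulrS rng_mulDl IHn.
Qed.

Lemma rng_mulrnAr x y n : (x * (y *+ n))%g = (x * y)%g *+ n.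
Proof.
by elim: n => [|n IHn]; rewrite ?rng_mul0r // !mulrS rng_mulDr IHn.
Qed.

(** The pair [(x, m)] stands for the formal sum [x + m]. *)
Definition adjoin1 : Type := R * nat.

HB.instance Definition _ := GRing.Nmodule.on adjoin1.

Definition adjoin1_mul (a b : adjoin1) : adjoin1 :=
  ((a.1 * b.1)%g + a.1 *+ b.2 + b.1 *+ a.2, (a.2 * b.2)%N).

Lemma adjoin1_mulA : associative adjoin1_mul.
Proof.
move=> [x m] [y n] [z p]; rewrite /adjoin1_mul /= mulnA; congr (_, _).
rewrite !rng_mulDl !rng_mulDr !mulrnDl !rng_mulrnAl !rng_mulrnAr.
rewrite mulgA -!mulrnA (mulnC n m) (mulnC p m) -!addrA; congr (_ + _).
rewrite [LHS]addrCA; congr (_ + _); rewrite [RHS]addrCA; congr (_ + _).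
exact: addrCA.
Qed.

Lemma adjoin1_mul1l : left_id (0, 1%N) adjoin1_mul.
Proof.
by move=> [x m]; rewrite /adjoin1_mul /= rng_mul0l mul0rn !add0r mul1n.
Qed.

Lemma adjoin1_mul1r : right_id (0, 1%N) adjoin1_mul.
Proof.
by move=> [x m]; rewrite /adjoin1_mul /= rng_mul0r mul0rn add0r addr0 muln1.
Qed.

Lemma adjoin1_mulDl : left_distributive adjoin1_mul +%R.
Proof.
move=> [x m] [y n] [z p]; congr (_, _); last exact: mulnDl.
rewrite /= rng_mulDl mulrnDl mulrnDr [X in X + _ = _]addrACA; exact: addrACA.
Qed.

Lemma adjoin1_mulDr : right_distributive adjoin1_mul +%R.
Proof.
move=> [x m] [y n] [z p]; congr (_, _); last exact: mulnDr.
rewrite /= rng_mulDr mulrnDl mulrnDr [X in X + _ = _]addrACA; exact: addrACA.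
Qed.

Lemma adjoin1_mul0l : left_zero 0 adjoin1_mul.
Proof.
by move=> [x m]; rewrite /adjoin1_mul /= rng_mul0l mul0rn mulr0n !addr0.
Qed.

Lemma adjoin1_mul0r : right_zero 0 adjoin1_mul.
Proof.
move=> [x m]; rewrite /adjoin1_mul /= rng_mul0r mul0rn mulr0n !addr0.
by rewrite muln0.
Qed.

HB.instance Definition _ := GRing.Nmodule_isPzSemiRing.Build adjoin1
  adjoin1_mulA adjoin1_mul1l adjoin1_mul1r adjoin1_mulDl adjoin1_mulDr
  adjoin1_mul0l adjoin1_mul0r.

Definition to_adjoin1 x : adjoin1 := (x, 0%N).

Lemma to_adjoin1D x y : to_adjoin1 (x + y) = to_adjoin1 x + to_adjoin1 y.
Proof. by []. Qed.

Lemma to_adjoin1M x y : to_adjoin1 (x * y)%g = to_adjoin1 x * to_adjoin1 y.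
Proof. by congr (_, _); rewrite /= !mulr0n !addr0. Qed.

Lemma to_adjoin1Mn x n : to_adjoin1 (x *+ n) = to_adjoin1 x *+ n.
Proof. by elim: n => // n IHn; rewrite !mulrS to_adjoin1D IHn. Qed.

(** Positivity of the exponent is essential: [rng_exp x 0] is a dummy value
    whereas [to_adjoin1 x ^+ 0] is the adjoined unit. *)
Lemma to_adjoin1X x n :
  (0 < n)%N -> to_adjoin1 (rng_exp x n) = to_adjoin1 x ^+ n.
Proof.
case: n => // n _; elim: n => // n IHn.
by rewrite exprS -IHn -to_adjoin1M.
Qed.

Lemma rng_expD_nilp_torsion x r (k m : nat) :
    commute x r -> (0 < k)%N -> rng_exp r k = 0 -> (0 < m)%N -> r *+ m = 0 ->
  rng_exp (x + r) (m * k`!) = rng_exp x (m * k`!).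
Proof.
move=> xr k_gt0 rk0 m_gt0 rm0.
have n_gt0 : (0 < m * k`!)%N by rewrite muln_gt0 m_gt0 fact_gt0.
suff /(congr1 fst) : to_adjoin1 (rng_exp (x + r) (m * k`!)) =
  to_adjoin1 (rng_exp x (m * k`!)) by [].
rewrite !to_adjoin1X // to_adjoin1D; apply: exprD_nilp_torsion.
- by rewrite /GRing.comm -!to_adjoin1M xr.
- by rewrite -to_adjoin1X // rk0.
- by rewrite -to_adjoin1Mn rm0.
Qed.

End AdjoinUnit.

Theorem theorem2p3 (R : rngType)
  (nil_central_torsion :
     forall r : R, nilpotent_elt r -> central_elt r /\ torsion_elt r) :
  nilperiod R.
Proof.
apply/nilperiodP => r _ r_nil.
have [r_central [m m_gt0 rm0]] := nil_central_torsion r r_nil.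
have [k k_gt0 rk0] := r_nil.
exists (m * k`!)%N => [|x]; first by rewrite muln_gt0 m_gt0 fact_gt0.
by apply: rng_expD_nilp_torsion => //; apply: commute_sym; apply: r_central.
Qed.
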